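(* Let $\Sigma$ be a signature. There exists a full and faithful functor $K_{\Sigma}$ from $\mathsf{Ssl}$ to $\int^{\mathsf{Ssl}}\mathrm{Isys}_{\Sigma}$ which is right adjoint to $\pi_{\mathrm{Isys}_{\Sigma}}$ and a right inverse of $\pi_{\mathrm{Isys}_{\Sigma}}$ (i.e. $\pi_{\mathrm{Isys}_{\Sigma}}\circ K_{\Sigma}=\mathrm{Id}_{\mathsf{Ssl}}$).
   Context: A signature $\Sigma=(\Sigma_n)_{n\in\mathbb{N}}$ assigns to each $n\in\mathbb{N}$ a set $\Sigma_n$ of operation symbols of arity $n$. A $\Sigma$-algebra $\mathbf{A}=(A,F)$ is a set $A$ with an operation $F_\sigma\colon A^n\to A$ for each $n$ and each $\sigma\in\Sigma_n$; the empty algebra is allowed when $\Sigma_0=\varnothing$. Homomorphisms are the maps preserving all operations; $\mathsf{Alg}(\Sigma)$ is the resulting category. A sup-semilattice is an ordered set $\mathbf{I}=(I,\leq)$ in which any two elements $i,j$ have a least upper bound $i\vee j$; morphisms are the maps preserving $\vee$; $\mathsf{Ssl}$ is the resulting category. For a sup-semilattice $\mathbf{I}$, an $\mathbf{I}$-inductive system of $\Sigma$-algebras is a pair $\mathcal{A}=((\mathbf{A}_i)_{i\in I},(f_{i,j})_{i\leq j})$ with $\mathbf{A}_i$ a $\Sigma$-algebra, $f_{i,j}\colon\mathbf{A}_i\to\mathbf{A}_j$ a homomorphism for $i\leq j$, $f_{i,i}=\mathrm{id}$, and $f_{j,k}\circ f_{i,j}=f_{i,k}$ for $i\leq j\leq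 k$. A morphism $u\colon\mathcal{A}\to((\mathbf{B}_i)_{i\in I},(g_{i,j})_{i\leq j})$ of $\mathbf{I}$-inductive systems is a family of homomorphisms $u_i\colon\mathbf{A}_i\to\mathbf{B}_i$ with $u_j\circ f_{i,j}=g_{i,j}\circ u_i$ for $i\leq j$. For $\xi\colon\mathbf{I}\to\mathbf{P}$ in $\mathsf{Ssl}$ and a $\mathbf{P}$-inductive system $\mathcal{B}=((\mathbf{B}_p)_{p\in P},(g_{p,q})_{p\leq q})$, put $\mathcal{B}_\xi=((\mathbf{B}_{\xi(i)})_{i\in I},(g_{\xi(i),\xi(j)})_{i\leq j})$. The category $\int^{\mathsf{Ssl}}\mathrm{Isys}_{\Sigma}$ (a Grothendieck construction) has as objects the pairs $(\mathbf{I},\mathcal{A})$ with $\mathbf{I}$ a sup-semilattice and $\mathcal{A}$ an $\mathbf{I}$-inductive system of $\Sigma$-algebras. A morphism $(\mathbf{I},\mathcal{A})\to(\mathbf{P},\mathcal{B})$ is a pair $(\xi,u)$ with $\xi\colon\mathbf{I}\to\mathbf{P}$ in $\mathsf{Ssl}$ and $u\colon\mathcal{A}\to\mathcal{B}_\xi$ a morphism of $\mathbf{I}$-inductive systems; composition is $(\psi,v)\circ(\xi,u)=(\psi\circ\xi,(v_{\xi(i)}\circ u_i)_{i\in I})$. The functor $\pi_{\mathrm{Isys}_{\Sigma}}\colon\int^{\mathsf{Ssl}}\mathrm{Isys}_{\Sigma}\to\mathsf{Ssl}$ sends $(\mathbf{I},\mathcal{A})$ to $\mathbf{I}$ and $(\xi,u)$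 to $\xi$. *)

(* Defs.v *)
From Stdlib Require Import Relation_Definitions FunctionalExtensionality ProofIrrelevance.
From Stdlib Require Vector.

Set Implicit Arguments.
Unset Strict Implicit.
Unset Printing Implicit Defensive.

Record category := Category {
  ob :> Type;
  hom : ob -> ob -> Type;
  idm : forall a, hom a a;
  comp : forall a b c, hom b c -> hom a b -> hom a c;
  comp_id_l : forall a b (f : hom a b), comp (idm b) f = f;
  comp_id_r : forall a b (f : hom a b), comp f (idm a) = f;
  comp_assoc : forall a b c d (h : hom c d) (g : hom b c) (f : hom a b),
    comp h (comp g f) = comp (comp h g) f
}.
Arguments hom {C} a b : rename.
Arguments idm {C} a : rename.
Arguments comp {C a b c} g f : rename.

Record functor (C D : category) := Functor {
  fob :> C -> D;
  fmap : forall a b : C, hom a b -> hom (fob a) (fob b);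
  fmap_id : forall a : C, fmap (idm a) = idm (fob a);
  fmap_comp : forall (a b c : C) (g : hom b c) (f : hom a b),
    fmap (comp g f) = comp (fmap g) (fmap f)
}.
Arguments fmap {C D} F {a b} f : rename.

Definition functor_id (C : category) : functor C C :=
  {| fob := fun a => a;
     fmap := fun a b f => f;
     fmap_id := fun a => eq_refl;
     fmap_comp := fun a b c g f => eq_refl |}.

Definition functor_comp (C D E : category) (G : functor D E) (F : functor C D) :
  functor C E :=
  {| fob := fun a => G (F a);
     fmap := fun a b f => fmap G (fmap F f);
     fmap_id := fun a => eq_trans (f_equal (fmap G) (fmap_id F a)) (fmap_id G (F a));
     fmap_comp := fun a b c g f =>
       eq_trans (f_equal (fmap G) (fmap_comp F g f)) (fmap_comp G (fmap F g) (fmap F f)) |}.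

Definition full (C D : category) (F : functor C D) : Prop :=
  forall (a b : C) (g : hom (F a) (F b)), exists f : hom a b, fmap F f = g.

Definition faithful (C D : category) (F : functor C D) : Prop :=
  forall (a b : C) (f g : hom a b), fmap F f = fmap F g -> f = g.

(* [F] is left adjoint to [G]: bijections [hom (F c) d ~ hom c (G d)], natural
   in [c] and [d]. *)
Record adjunction (C D : category) (F : functor C D) (G : functor D C) := Adjunction {
  transpose : forall (c : C) (d : D), hom (F c) d -> hom c (G d);
  untranspose : forall (c : C) (d : D), hom c (G d) -> hom (F c) d;
  transposeK : forall c d (f : hom (F c) d), untranspose (transpose f) = f;
  untransposeK : forall c d (g : hom c (G d)), transpose (untranspose g) = g;
  transpose_natural :
    forall (c c' : C) (d d' : D) (h : hom c' c) (k : hom d d') (f : hom (F c) d),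
      transpose (comp k (comp f (fmap F h))) = comp (fmap G k) (comp (transpose f) h)
}.

Definition right_adjoint_to (C D : category) (G : functor D C) (F : functor C D) : Prop :=
  inhabited (adjunction F G).

Definition is_join (T : Type) (le : relation T) (x y z : T) : Prop :=
  le x z /\ le y z /\ forall w, le x w -> le y w -> le z w.

(* The carrier may be empty. *)
Record ssl := SupSemilattice {
  ssl_car :> Type;
  leq : relation ssl_car;
  leq_order : order ssl_car leq;
  leq_join : forall i j : ssl_car, exists k, is_join leq i j k
}.
Arguments leq {s} x y : rename.

(* As joins are unique, this says that [xi (i \/ j) = xi i \/ xi j]. *)
Record ssl_hom (I P : ssl) := SslHom {
  ssl_fun :> I -> P;
  ssl_fun_join : forall i j k : I,
    is_join leq i j k -> is_join leq (ssl_fun i) (ssl_fun j) (ssl_fun k)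
}.

Lemma ssl_hom_mono (I P : ssl) (xi : ssl_hom I P) (i j : I) :
  leq i j -> leq (xi i) (xi j).
Proof.
  intro ij.
  assert (jn : is_join leq i j j).
  { split; [exact ij | split; [apply (ord_refl _ _ (leq_order I)) | auto]]. }
  apply (ssl_fun_join xi jn).
Qed.

Definition ssl_id (I : ssl) : ssl_hom I I :=
  {| ssl_fun := fun i => i; ssl_fun_join := fun i j k H => H |}.

Definition ssl_comp (I P Q : ssl) (psi : ssl_hom P Q) (xi : ssl_hom I P) : ssl_hom I Q :=
  {| ssl_fun := fun i => psi (xi i);
     ssl_fun_join := fun i j k H => ssl_fun_join psi (ssl_fun_join xi H) |}.

Lemma ssl_hom_eq (I P : ssl) (xi xi' : ssl_hom I P) :
  (forall i, xi i = xi' i) -> xi = xi'.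
Proof.
  destruct xi as [f p], xi' as [g q]; simpl; intro E.
  apply functional_extensionality in E; subst g.
  f_equal; apply proof_irrelevance.
Qed.

Definition Ssl : category.
Proof.
  refine {| ob := ssl; hom := ssl_hom; idm := ssl_id; comp := ssl_comp |};
    intros; apply ssl_hom_eq; reflexivity.
Defined.

Definition signature := nat -> Type.

Section Algebras.
Variable Sigma : signature.

Record algebra := Algebra {
  alg_car :> Type;
  alg_op : forall n, Sigma n -> Vector.t alg_car n -> alg_car
}.

Record alg_hom (A B : algebra) := AlgHom {
  alg_fun :> A -> B;
  alg_fun_op : forall n (s : Sigma n) (v : Vector.t A n),
    alg_fun (alg_op s v) = alg_op s (Vector.map alg_fun v)
}.

Lemma alg_hom_eq (A B : algebra) (u v : alg_hom A B) : (forall x, u x = v x) -> u = v.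
Proof.
  destruct u as [f p], v as [g q]; simpl; intro E.
  apply functional_extensionality in E; subst g.
  f_equal; apply proof_irrelevance.
Qed.

Lemma alg_id_op (A : algebra) n (s : Sigma n) (v : Vector.t A n) :
  alg_op s v = alg_op s (Vector.map (fun x => x) v).
Proof. now rewrite Vector.map_id. Qed.

Definition alg_id (A : algebra) : alg_hom A A :=
  {| alg_fun := fun x => x; alg_fun_op := @alg_id_op A |}.

Lemma alg_comp_op (A B C : algebra) (g : alg_hom B C) (f : alg_hom A B)
    n (s : Sigma n) (v : Vector.t A n) :
  g (f (alg_op s v)) = alg_op s (Vector.map (fun x => g (f x)) v).
Proof. now rewrite !alg_fun_op, Vector.map_map. Qed.

Definition alg_comp (A B C : algebra) (g : alg_hom B C) (f : alg_hom A B) : alg_hom A C :=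
  {| alg_fun := fun x => g (f x); alg_fun_op := alg_comp_op g f |}.

(* Proofs of [leq i j] are irrelevant, so [isys_map] amounts to one homomorphism
   for each pair [i <= j]. *)
Record isys (I : ssl) := Isys {
  isys_alg :> I -> algebra;
  isys_map : forall i j : I, leq i j -> alg_hom (isys_alg i) (isys_alg j);
  isys_map_id : forall (i : I) (ii : leq i i), isys_map ii = alg_id (isys_alg i);
  isys_map_comp : forall (i j k : I) (ij : leq i j) (jk : leq j k) (ik : leq i k),
    alg_comp (isys_map jk) (isys_map ij) = isys_map ik
}.
Arguments isys_map {I} A {i j} ij : rename.

Lemma isys_map_irrelevant (I : ssl) (A : isys I) (i j : I) (ij ij' : leq i j) (x : A i) :
  isys_map A ij x = isys_map A ij' x.
Proof. now rewrite (proof_irrelevance _ ij ij'). Qed.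

Record isys_hom (I : ssl) (A B : isys I) := IsysHom {
  isys_fun :> forall i : I, alg_hom (A i) (B i);
  isys_fun_natural : forall (i j : I) (ij : leq i j),
    alg_comp (isys_fun j) (isys_map A ij) = alg_comp (isys_map B ij) (isys_fun i)
}.

Definition reindex (I P : ssl) (xi : ssl_hom I P) (B : isys P) : isys I :=
  {| isys_alg := fun i => B (xi i);
     isys_map := fun i j ij => isys_map B (ssl_hom_mono xi ij);
     isys_map_id := fun i ii => isys_map_id B (ssl_hom_mono xi ii);
     isys_map_comp := fun i j k ij jk ik =>
       isys_map_comp B (ssl_hom_mono xi ij) (ssl_hom_mono xi jk) (ssl_hom_mono xi ik) |}.

Record tot := Tot { tot_base : ssl; tot_sys : isys tot_base }.

Record tot_hom (X Y : tot) := TotHom {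
  tot_hom_base : ssl_hom (tot_base X) (tot_base Y);
  tot_hom_sys : isys_hom (tot_sys X) (reindex tot_hom_base (tot_sys Y))
}.

Lemma tot_hom_eq (X Y : tot) (f : tot_base X -> tot_base Y) p p'
    (u : isys_hom (tot_sys X) (reindex (SslHom (ssl_fun := f) p) (tot_sys Y)))
    (u' : isys_hom (tot_sys X) (reindex (SslHom (ssl_fun := f) p') (tot_sys Y))) :
  (forall i x, u i x = u' i x) -> TotHom u = TotHom u'.
Proof.
  destruct (proof_irrelevance _ p p').
  intro E; f_equal.
  destruct u as [u n], u' as [u' n']; simpl in E.
  assert (u = u') as <-
    by (apply functional_extensionality_dep; intro i; apply alg_hom_eq, E).
  f_equal; apply proof_irrelevance.
Qed.

Lemma tot_id_natural (X : tot) (i j : tot_base X) (ij : leq i j) :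
  alg_comp (alg_id _) (isys_map (tot_sys X) ij) =
  alg_comp (isys_map (reindex (ssl_id _) (tot_sys X)) ij) (alg_id _).
Proof.
  apply alg_hom_eq; intro x; simpl.
  apply (@isys_map_irrelevant _ (tot_sys X) i j).
Qed.

Definition tot_id (X : tot) : tot_hom X X :=
  {| tot_hom_base := ssl_id (tot_base X);
     tot_hom_sys :=
       {| isys_fun := fun i => alg_id (tot_sys X i)
            : alg_hom (tot_sys X i) (reindex (ssl_id _) (tot_sys X) i);
          isys_fun_natural := @tot_id_natural X |} |}.

Section Composition.
Variables (X Y Z : tot) (g : tot_hom Y Z) (f : tot_hom X Y).

Let base : ssl_hom (tot_base X) (tot_base Z) :=
  ssl_comp (tot_hom_base g) (tot_hom_base f).

Definition tot_comp_fun (i : tot_base X) :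
    alg_hom (tot_sys X i) (reindex base (tot_sys Z) i) :=
  alg_comp (tot_hom_sys g (tot_hom_base f i)) (tot_hom_sys f i).

Lemma tot_comp_natural (i j : tot_base X) (ij : leq i j) :
  alg_comp (tot_comp_fun j) (isys_map (tot_sys X) ij) =
  alg_comp (isys_map (reindex base (tot_sys Z)) ij) (tot_comp_fun i).
Proof.
  apply alg_hom_eq; intro x; simpl.
  pose proof (f_equal (fun h => alg_fun h x)
    (isys_fun_natural (tot_hom_sys f) ij)) as E; simpl in E; rewrite E.
  pose proof (f_equal (fun h => alg_fun h (tot_hom_sys f i x))
    (isys_fun_natural (tot_hom_sys g) (ssl_hom_mono (tot_hom_base f) ij))) as E'.
  simpl in E'; rewrite E'.
  apply (@isys_map_irrelevant _ (tot_sys Z) (base i) (base j)).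
Qed.

Definition tot_comp : tot_hom X Z :=
  {| tot_hom_base := base;
     tot_hom_sys := {| isys_fun := tot_comp_fun; isys_fun_natural := tot_comp_natural |} |}.
End Composition.

Definition IntIsys : category.
Proof.
  refine {| ob := tot; hom := tot_hom; idm := tot_id; comp := tot_comp |}.
  - intros X Y [[f p] u]; apply tot_hom_eq; reflexivity.
  - intros X Y [[f p] u]; apply tot_hom_eq; reflexivity.
  - intros W X Y Z h g f; apply tot_hom_eq; reflexivity.
Defined.

Definition pi_Isys : functor IntIsys Ssl :=
  {| fob := tot_base : IntIsys -> Ssl;
     fmap := fun X Y (f : tot_hom X Y) => tot_hom_base f;
     fmap_id := fun X => eq_refl;
     fmap_comp := fun X Y Z g f => eq_refl |}.

End Algebras.

(* Main.v *)
(** Let [K I] be the constant [I]-inductive system on the one-point algebra. Each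
    semilattice morphism from the base of [X] to [I] carries exactly one morphism
    from [X] to [K I]; this gives the adjunction and, with [X = K J], full
    faithfulness. *)
From Stdlib Require Import ProofIrrelevance.
Require Import Defs.

Set Implicit Arguments.
Unset Strict Implicit.
Unset Printing Implicit Defensive.

Section TerminalSystem.
Variable Sigma : signature.

Definition unit_alg : algebra Sigma :=
  {| alg_car := unit; alg_op := fun n s v => tt |}.

Definition to_unit_alg (A : algebra Sigma) : alg_hom A unit_alg :=
  {| alg_fun := fun _ : A => tt : unit_alg; alg_fun_op := fun n s v => eq_refl |}.

(** With [to_unit_alg], this makes the one-point algebra terminal, also when [A] is empty. *)
Lemma to_unit_alg_unique (A : algebra Sigma) (u v : alg_hom A unit_alg) : u = v.
Proof. apply alg_hom_eq; intro x; now destruct (u x), (v x). Qed.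

Definition unit_isys (I : ssl) : isys Sigma I :=
  {| isys_alg := fun _ => unit_alg;
     isys_map := fun i j ij => alg_id unit_alg;
     isys_map_id := fun i ii => eq_refl;
     isys_map_comp := fun i j k ij jk ik => to_unit_alg_unique _ _ |}.

Definition unit_tot (I : ssl) : tot Sigma := Tot (unit_isys I).

Definition to_unit_tot (X : tot Sigma) (I : ssl) (xi : ssl_hom (tot_base X) I) :
    tot_hom X (unit_tot I) :=
  @TotHom Sigma X (unit_tot I) xi
    {| isys_fun := fun i => to_unit_alg (tot_sys X i)
         : alg_hom (tot_sys X i) (reindex xi (unit_isys I) i);
       isys_fun_natural := fun i j ij => to_unit_alg_unique _ _ |}.

Lemma to_unit_tot_unique (X : tot Sigma) (I : ssl) (f g : tot_hom X (unit_tot I)) :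
  tot_hom_base f = tot_hom_base g -> f = g.
Proof.
  destruct f as [[f p] u], g as [xi v]; simpl; intros <-.
  apply tot_hom_eq; intros i x.
  exact (f_equal (fun w => alg_fun w x) (to_unit_alg_unique (u i) (v i))).
Qed.

Definition unit_functor : functor Ssl (IntIsys Sigma).
Proof.
  refine (@Functor Ssl (IntIsys Sigma) unit_tot
    (fun I J xi => @to_unit_tot (unit_tot I) J xi) _ _);
    (* Both sides of each functor law have the same base. *)
    intros; now apply to_unit_tot_unique.
Defined.

Lemma unit_functor_full : full unit_functor.
Proof.
  intros I J g; exists (tot_hom_base g); now apply to_unit_tot_unique.
Qed.

(** Taking bases undoes [unit_functor] on morphisms. *)
Lemma unit_functor_faithful : faithful unit_functor.
Proof. intros I J f g E; exact (f_equal (@tot_hom_base _ _ _) E). Qed.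

Definition pi_unit_adjunction : adjunction (pi_Isys Sigma) unit_functor.
Proof.
  refine (@Adjunction _ _ (pi_Isys Sigma) unit_functor
    (fun X I xi => @to_unit_tot X I xi) (fun X I f => tot_hom_base f) _ _ _).
  (* The base of [to_unit_tot xi] is [xi] by computation; the other two laws compare morphisms into
     a [unit_tot], so uniqueness gives them. *)
  - reflexivity.
  - intros; now apply to_unit_tot_unique.
  - intros; now apply to_unit_tot_unique.
Defined.

(** The object and morphism parts agree by computation; only the proofs of the functor laws remain
    to be identified. *)
Lemma pi_unit_functor : functor_comp (pi_Isys Sigma) unit_functor = functor_id Ssl.
Proof. unfold functor_comp, functor_id; simpl; f_equal; apply proof_irrelevance. Qed.

End TerminalSystem.

Theorem proposition3p7 (Sigma : signature) :
  exists K : functor Ssl (IntIsys Sigma),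
    full K /\ faithful K /\
    right_adjoint_to K (pi_Isys Sigma) /\
    functor_comp (pi_Isys Sigma) K = functor_id Ssl.
Proof.
  exists (unit_functor Sigma); repeat split.
  - apply unit_functor_full.
  - apply unit_functor_faithful.
  - apply pi_unit_adjunction.
  - apply pi_unit_functor.
Qed.
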